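(* Let $f_{UB-C}$ be the piecewise-linear function defined on $[2,\infty)$ that corresponds to the polyline connecting $$(2,f(2))\to(4,f(4))\to\cdots\to(2i,f(2i))\to\cdots\to(2k,f(2k))\to(\infty,f(2k)).$$ For any $(L,T)$ satisfying $$(T-1)f_{UB-C}\Big(\frac{L}{T-1}\Big)=N-2k^2,$$ there exists a feasible pair $(L',T')$ for the C-CPPG, derived from a mixed up-and-down path, such that $$L'-L\le\frac{2k^2}{N-2k^2}L+10m\qquad\text{and}\qquad T'-T\le\frac{2k^2}{N-2k^2}T+10m+12 .$$ Moreover, the equation $(T-1)f_{UB-C}\big(\frac{L}{T-1}\big)=N-2k^2$ is a polyline connecting $$\Big(\frac{2N^*}{f(2)},\frac{N^*}{f(2)}\Big)\to\Big(\frac{4N^*}{f(4)},\frac{N^*}{f(4)}\Big)\to\cdots\to\Big(\frac{2iN^*}{f(2i)},\frac{N^*}{f(2i)}\Big)\to\cdots\to\Big(\frac{2kN^*}{f(2k)},\frac{N^*}{f(2k)}\Big)\to\Big(\infty,\frac{N^*}{f(\infty)}\Big),$$ where $N^*=N-2k^2$.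
   Context: Let $m\ge n>0$ be integers, $D=\{(x,y)\in\mathbb{R}^2: 0\le x\le n,\ 0\le y\le m\}$, $N=mn$ the area of $D$, and $D_{int}=D\cap\mathbb{Z}^2$. The unit grid is the graph on $D_{int}$ in which points at distance 1 are joined by an edge of length 1. Distances are measured in the $\ell_1$ norm. The function $f$ is $f(d)=d\big(2k-\frac d2\big)$ for $d\in(0,2k]$ and $f(d)=2k^2$ for $d\in(2k,\infty)$; $f(\infty)=f(2k)=2k^2$. C-CPPG (continuous covering path problem on a grid), with coverage radius $k$ a positive integer: one selects a set of stops $V_1\subseteq D_{int}$ such that every point of $D$ is within distance $k$ of some stop, and a path in the grid connecting the stops (a covering path). The path length is the total length of its edges and the stop count is the number of stops. A pair $(L,T)$ is feasible if there is a covering path with at most $T$ stops and path length at most $L$. Type-$d$ up-and-down path ($0<d\le 2k$) on a rectangle of height $m$: with $r=2k-\frac d2$, it connects sequentially $(0,0)\to(0,m)\to(r,m)\to(r,0)\to(2r,0)\to(2r,m)\to(3r,m)\to(3r,0)\to\cdots$ (coordinates relative to the lower left corner of the rectangle). The vertical segments are called traversals; consecutive traversals are separated by $r$, except possibly for the rightmost one, where the separation is at most $r$. On the traversals at $x=2ir$ ($i=0,1,\dots$) there are stops at heights $jd\le m$ ($j=0,1,\dots$); on the traversals at $x=(2i+1)r$ there are stops at heights $jd+\frac d2\le m$ ($j=0,1,\dots$); in addition there is a stop at height $m$ on each traversal. Type-$(d,\gamma)$ mixed up-and-down path, for even $d\in\{1,\dots,2k-2\}$ and $\gamma\in[0,1)$: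 divide the $m\times n$ rectangle into two rectangles of sizes $\lceil\gamma n\rceil\times m$ and $\lceil(1-\gamma)n\rceil\times m$; cover the first with a type-$d$ up-and-down path and the second with a type-$(d+2)$ up-and-down path, and connect the two paths at the common boundary of the two rectangles.
   Formalization: The polyline is stated for the points (L, T−1), since with (L, T) the printed vertices do not satisfy the equation; for k = 1, where no even d exists, the pure type-2 up-and-down path counts as mixed; N > 2k² is assumed, as T > 1 forces. *)

(* Defs.v *)
From HB Require Import structures.
From mathcomp Require Import all_boot all_order all_algebra.
From mathcomp Require Import finmap.
From mathcomp Require Import classical_sets reals.
From mathcomp Require Import ring lra.

Set Implicit Arguments.
Unset Strict Implicit.
Unset Printing Implicit Defensive.

Import Order.TTheory GRing.Theory Num.Theory.

Local Open Scope ring_scope.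

(* Throughout, the region is D = [0, n] x [0, m] and points of D_int are pairs
   (x, y) of natural numbers with x <= n and y <= m. *)

Definition l1dist (R : realType) (p q : R * R) : R :=
  `|p.1 - q.1| + `|p.2 - q.2|.

Definition region (R : realType) (n m : nat) : set (R * R) :=
  [set p | 0 <= p.1 <= n%:R /\ 0 <= p.2 <= m%:R]%classic.

Definition grid_point (n m : nat) (p : nat * nat) : bool :=
  ((p.1 <= n) && (p.2 <= m))%N.

Definition grid_adj (p q : nat * nat) : bool :=
  (`|p.1%:Z - q.1%:Z| + `|p.2%:Z - q.2%:Z| == 1)%N.

Definition embed (R : realType) (p : nat * nat) : R * R := (p.1%:R, p.2%:R).

(* A path is the list of its successive vertices; a vertex or an edge may be
   visited several times, and an edge contributes to the length each time. *)
Definition path_length (w : seq (nat * nat)) : nat := (size w).-1.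

Definition covering_path (R : realType) (k n m : nat)
    (S : {fset nat * nat}) (w : seq (nat * nat)) : Prop :=
  [/\ forall s, s \in S -> grid_point n m s,
      forall p : R * R, region n m p ->
        exists2 s, s \in S & l1dist p (embed R s) <= k%:R,
      all (grid_point n m) w /\ sorted grid_adj w
    & forall s, s \in S -> s \in w].

Definition feasible (R : realType) (k n m : nat) (L T : R) : Prop :=
  exists S w, [/\ covering_path R k n m S w,
                  (#|` S|)%:R <= T & (path_length w)%:R <= L].

(* The lattice points after a until b. *)
Definition steps (a b : nat) : seq nat :=
  if (a <= b)%N then iota a.+1 (b - a) else rev (iota b (a - b)).

(* The grid points after p on the way to q, first along x and then along y. *)
Definition route (p q : nat * nat) : seq (nat * nat) :=
  [seq (x, p.2) | x <- steps p.1 q.1] ++ [seq (q.1, y) | y <- steps p.2 q.2].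

Definition walk_through (c : seq (nat * nat)) : seq (nat * nat) :=
  if c is p :: c' then p :: flatten (pairmap route p c') else [::].

(* In the next definitions d is even, so that d./2 and the separation
   r = 2k - d/2 of the traversals are integers. *)
Definition separation (k d : nat) : nat := (2 * k - d./2)%N.

(* Abscissae of the traversals of a type-d path on a rectangle of width w,
   relative to its left side: the multiples of r below w, and then w.
   A rectangle of width 0 is empty and gets no traversal. *)
Definition traversals (k d w : nat) : seq nat :=
  if w is 0 then [::] else
  let r := separation k d in rcons (mkseq (muln r) (w.-1 %/ r).+1) w.

(* Heights of the stops on the i-th traversal; since d./2 < d, the heights
   d./2 + j * d are those congruent to d./2 modulo d. *)
Definition stop_heights (d m i : nat) : seq nat :=
  m :: [seq y <- iota 0 m.+1 | y == (if odd i then d./2 else 0) %[mod d]].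

(* Stops, and corners in the order of visit, of the type-d path on the
   rectangle [x0, x0 + w] x [0, m]. *)
Definition ud_stops (k d m x0 w : nat) : seq (nat * nat) :=
  let xs := traversals k d w in
  [seq ((x0 + nth 0 xs i)%N, y) | i <- iota 0 (size xs), y <- stop_heights d m i].

Definition ud_corners (k d m x0 w : nat) : seq (nat * nat) :=
  let xs := traversals k d w in
  flatten [seq let x := (x0 + nth 0 xs i)%N in
               if odd i then [:: (x, m); (x, 0%N)] else [:: (x, 0%N); (x, m)]
          | i <- iota 0 (size xs)].

(* For k = 1 no even d satisfies 1 <= d <= 2k - 2; the only even type is then
   2 = 2k, and the pure type-2 path is admitted, as (d, gamma) = (0, 0). *)
Definition mixed_type (R : realType) (k d : nat) (gamma : R) : Prop :=
  [/\ ~~ odd d, (d <= 2 * k - 2)%N, 0 <= gamma < 1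
    & (1 <= d)%N \/ (k = 1%N /\ gamma = 0)].

Definition left_width (R : realType) (n : nat) (gamma : R) : nat :=
  `|Num.ceil (gamma * n%:R)|%N.

Definition right_width (R : realType) (n : nat) (gamma : R) : nat :=
  `|Num.ceil ((1 - gamma) * n%:R)|%N.

(* The left rectangle is flush with x = 0 and the right one with x = n.  Their
   common boundary is a line if gamma * n is an integer; otherwise the two
   widths add up to n + 1 and the rectangles share a strip of width 1. *)
Definition right_start (R : realType) (n : nat) (gamma : R) : nat :=
  (n - right_width n gamma)%N.

Definition mixed_stops (R : realType) (k n m d : nat) (gamma : R)
    : {fset nat * nat} :=
  [fset p in ud_stops k d m 0 (left_width n gamma)
          ++ ud_stops k d.+2 m (right_start n gamma) (right_width n gamma)]%fset.

(* The two paths are joined by the route, within the common boundary, from the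
   last corner of the first path to the first corner of the second one. *)
Definition mixed_walk (R : realType) (k n m d : nat) (gamma : R)
    : seq (nat * nat) :=
  walk_through
    (ud_corners k d m 0 (left_width n gamma)
     ++ ud_corners k d.+2 m (right_start n gamma) (right_width n gamma)).

Definition from_mixed_path (R : realType) (k n m : nat) (L T : R) : Prop :=
  exists (d : nat) (gamma : R),
    [/\ mixed_type k d gamma,
        covering_path R k n m (mixed_stops k n m d gamma)
                              (mixed_walk k n m d gamma),
        L = (path_length (mixed_walk k n m d gamma))%:R
      & T = (#|` mixed_stops k n m d gamma|)%:R].

Definition f_cov (R : realType) (k : nat) (d : R) : R :=
  if d <= 2 * k%:R then d * (2 * k%:R - d / 2) else 2 * k%:R ^+ 2.

Definition f_cov_infty (R : realType) (k : nat) : R := 2 * k%:R ^+ 2.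

(* v 1 -> v 2 -> ... -> v k -> (oo, yoo), where yoo is the ordinate of v k, so
   that the last piece is a horizontal ray. *)
Definition polyline_to_infty (R : realType) (k : nat) (v : nat -> R * R)
    (yoo : R) : set (R * R) :=
  [set p | (exists i t, [/\ (1 <= i < k)%N, 0 <= t <= 1,
               p.1 = (1 - t) * (v i).1 + t * (v i.+1).1
             & p.2 = (1 - t) * (v i).2 + t * (v i.+1).2])
           \/ ((v k).1 <= p.1 /\ p.2 = yoo)]%classic.

(* Meaningful for x >= 2 only: on [2i, 2i+2] with 1 <= i < k, linear
   interpolation of f_cov between 2i and 2i + 2; constant from 2k on. *)
Definition f_UBC (R : realType) (k : nat) (x : R) : R :=
  if 2 * k%:R <= x then f_cov k (2 * k%:R) else
  let i := Num.truncn (x / 2) in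
  let a := f_cov k (2 * i%:R) in
  let b := f_cov k (2 * i.+1%:R) in
  a + (x - 2 * i%:R) / 2 * (b - a).

(* L / (T - 1) has to lie in the domain of f_UBC; this excludes T = 1, as
   L / 0 = 0. *)
Definition UBC_equation (R : realType) (k n m : nat) (L T : R) : Prop :=
  2 <= L / (T - 1) /\
  (T - 1) * f_UBC k (L / (T - 1)) = (m * n)%:R - 2 * k%:R ^+ 2.

Lemma f_cov2k (R : realType) (k : nat) : f_cov k (2 * k%:R) = f_cov_infty R k.
Proof. by rewrite /f_cov lexx /f_cov_infty; field. Qed.

(* f_UBC is the function on [2, oo) whose graph is the polyline
   (2, f 2) -> (4, f 4) -> ... -> (2k, f (2k)) -> (oo, f oo). *)
Lemma f_UBC_graph (R : realType) (k : nat) (x y : R) : (0 < k)%N ->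
  (2 <= x /\ y = f_UBC k x) <->
  polyline_to_infty k (fun i => (2 * i%:R, f_cov k (2 * i%:R)))
                      (f_cov_infty R k) (x, y).
Proof.
move=> k0; rewrite /polyline_to_infty /=; split.
- move=> [x2 ->]; rewrite /f_UBC f_cov2k.
  case: leP => [xk|xk]; first by right.
  left; have x0 : 0 <= x / 2 by lra.
  have /andP[lo hi] := truncn_itv x0.
  set i := Num.truncn (x / 2) in lo hi *.
  exists i, ((x - 2 * i%:R) / 2).
  have iS : i.+1%:R = i%:R + 1 :> R by rewrite -natr1.
  rewrite iS in hi *; split.
  + apply/andP; split; first by rewrite truncn_ge_nat //; lra.
    by rewrite -(ltr_nat R); lra.
  + by apply/andP; split; lra.
  + by field.
  + by field.
- case=> [[i [t [ir tr xE yE]]]|[xk ->]]; last first.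
    have k1 : 1 <= k%:R :> R by rewrite ler1n.
    by split; [lra | rewrite /f_UBC ifT // f_cov2k].
  have /andP[i1 ik] := ir; have /andP[t0 t1] := tr; rewrite {}xE {}yE.
  have iS : i.+1%:R = i%:R + 1 :> R by rewrite -natr1.
  have i1' : 1 <= i%:R :> R by rewrite ler1n.
  have ik' : i.+1%:R <= k%:R :> R by rewrite ler_nat.
  have -> : (1 - t) * (2 * i%:R) + t * (2 * i.+1%:R) = 2 * (i%:R + t) :> R.
    by rewrite iS; ring.
  split; first by lra.
  rewrite /f_UBC; case: (ltP t 1) => [tlt|tge].
    rewrite leNgt; have -> /= : 2 * (i%:R + t) < 2 * k%:R :> R.
      by rewrite iS in ik'; lra.
    have -> : Num.truncn (2 * (i%:R + t) / 2 : R) = i.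
      by apply: truncn_def; rewrite iS; apply/andP; split; lra.
    by field.
  have -> : t = 1 by lra.
  rewrite subrr mul0r add0r mul1r -iS.
  case: leP => [ki|ik2].
    by congr (f_cov _ (2 * _)); apply/eqP; rewrite eq_le ik'; lra.
  have -> : Num.truncn (2 * i.+1%:R / 2 : R) = i.+1.
    by apply: truncn_def; rewrite -[i.+2%:R]natr1; apply/andP; split; lra.
  by rewrite subrr mul0r mul0r addr0.
Qed.

(* Main.v *)
Require Import Defs.
From mathcomp Require Import all_boot all_order all_algebra.
From mathcomp Require Import finmap reals.
From mathcomp Require Import zify ring lra.

(* Between two neighbouring traversals at distance at most r = 2k - d/2, the stops
   are interleaved so that the vertical distances from a point to the nearest
   stops on either side add up to at most d/2; the two l1 distances then add up
   to at most 2k, and one of them is at most k.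

   A type-d path on a rectangle of width w has at most w/r + 2 traversals, of
   length m and with at most m/d + 2 stops each, and f(d) = d r.  On an edge of
   the polyline, L = Ns (g/r1 + (1-g)/r2) and T - 1 = Ns (g/f(d) + (1-g)/f(d+2))
   with Ns = N - 2k^2, so that the mixed path of ratio g exceeds N/Ns times these
   values by a linear function of m only. *)

Set Implicit Arguments.
Unset Strict Implicit.
Unset Printing Implicit Defensive.

Import Order.TTheory GRing.Theory Num.Theory.

Local Open Scope ring_scope.

(** * Lattice segments and routes between grid points *)

Lemma size_steps a b : size (steps a b) = (maxn a b - minn a b)%N.
Proof. by rewrite /steps; case: leqP => ab; rewrite ?size_rev size_iota; lia. Qed.

Lemma mem_steps a b x :
  (x \in a :: steps a b) = (minn a b <= x <= maxn a b)%N.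
Proof.
rewrite inE /steps; case: leqP => ab; rewrite ?mem_rev mem_iota; lia.
Qed.

Lemma last_steps a b : last a (steps a b) = b.
Proof.
rewrite /steps; case: leqP => ab; first by rewrite (last_nth 0) size_iota;
  case: (posnP (b - a)) => [e|ba]; [rewrite e /=; lia |
    rewrite -(prednK ba) /= -[_ :: _]/(iota a.+1 _.+1) nth_iota; lia].
have -> : (a - b)%N = (a - b).-1.+1 by lia.
by rewrite rev_cons last_rcons.
Qed.

Lemma path_steps a b :
  path (fun x y => (y == x.+1) || (x == y.+1)) a (steps a b).
Proof.
have up c l : path (fun x y => y == x.+1) c (iota c.+1 l).
  by elim: l c => //= l IH c; rewrite eqxx IH.
rewrite /steps; case: leqP => ab.
  by move: (up a (b - a)%N); apply: sub_path => x y /= ->.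
(* A descending list of steps is the reverse of the ascending list from b to a, without its first
   entry a. *)
have -> : rev (iota b (a - b)) = behead (rev (b :: iota b.+1 (a - b))).
  by rewrite -[_ :: _]/(iota b (a - b).+1) -addn1 iotaD rev_cat.
have: head 0%N (rev (b :: iota b.+1 (a - b))) = a.
  rewrite -[_ :: _]/(iota b (a - b).+1) -addn1 iotaD rev_cat /=; lia.
move: (b :: _) (up b (a - b)%N : sorted _ (b :: _)) => s up_s ha.
have : sorted (fun x y => x == y.+1) (rev s).
  by rewrite rev_sorted.
case: (rev s) ha => //= c l ->; apply: sub_path => x y /= ->; exact: orbT.
Qed.

(** The l1 distance in [nat]: [maxn] minus [minn] is an absolute difference unaffected by truncated
    subtraction. *)
Definition grid_dist (p q : nat * nat) : nat :=
  (maxn p.1 q.1 - minn p.1 q.1 + (maxn p.2 q.2 - minn p.2 q.2))%N.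

Lemma size_route p q : size (route p q) = grid_dist p q.
Proof. by rewrite size_cat !size_map !size_steps. Qed.

Lemma last_route p q : last p (route p q) = q.
Proof.
case: p q => [a b] [c e]; rewrite /route last_cat /=.
by rewrite (last_map (fun x => (x, b)) _ a) last_steps (last_map (pair c) _ b) last_steps.
Qed.

Lemma path_route p q : path grid_adj p (route p q).
Proof.
case: p q => [a b] [c e]; rewrite /route cat_path /=.
rewrite (last_map (fun x => (x, b)) _ a) last_steps.
rewrite (path_map (f := fun x => (x, b)) a) (path_map (f := pair c) b).
by apply/andP; split; [move: (path_steps a c) | move: (path_steps b e)];
  apply: sub_path => x y; rewrite /grid_adj /=; lia.
Qed.

Lemma grid_point_route n m p q : grid_point n m p -> grid_point n m q ->
  all (grid_point n m) (route p q).
Proof.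
case: p q => [a b] [c e] /andP[/= an bm] /andP[/= cn em].
have in_steps u v x : x \in steps u v -> (minn u v <= x <= maxn u v)%N.
  by move=> xs; rewrite -mem_steps inE xs orbT.
rewrite /route all_cat !all_map; apply/andP; split; apply/allP => x /in_steps;
  rewrite /grid_point /=; lia.
Qed.

Lemma mem_vertical_route x y0 y1 y : (minn y0 y1 <= y <= maxn y0 y1)%N ->
  (x, y) \in (x, y0) :: route (x, y0) (x, y1).
Proof.
rewrite -mem_steps !inE /route mem_cat => /predU1P[->|ys]; first by rewrite eqxx.
by rewrite [_ \in map (pair x) _]map_f ?orbT.
Qed.

(** * Walks through lists of corners, and zigzags *)

(** The tail of [walk_through (p :: c)], with the current position as a parameter, which suits
    concatenation and induction on the corners. *)
Definition walk_from (p : nat * nat) (c : seq (nat * nat)) :=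
  flatten (pairmap route p c).

Lemma walk_from_cons p q c : walk_from p (q :: c) = route p q ++ walk_from q c.
Proof. by []. Qed.

Lemma walk_from_cat p c1 c2 :
  walk_from p (c1 ++ c2) = walk_from p c1 ++ walk_from (last p c1) c2.
Proof. by rewrite /walk_from pairmap_cat flatten_cat. Qed.

Lemma last_walk_from p c : last p (walk_from p c) = last p c.
Proof. by elim: c p => //= q c IH p; rewrite walk_from_cons last_cat last_route. Qed.

Lemma path_walk_from p c : path grid_adj p (walk_from p c).
Proof.
by elim: c p => //= q c IH p; rewrite walk_from_cons cat_path path_route last_route IH.
Qed.

Lemma grid_point_walk_from n m p c : grid_point n m p -> all (grid_point n m) c ->
  all (grid_point n m) (walk_from p c).
Proof.
elim: c p => //= q c IH p gp /andP[gq gc].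
by rewrite walk_from_cons all_cat grid_point_route // IH.
Qed.

(* b tells whether the first traversal is travelled downwards. *)
Fixpoint zigzag (m : nat) (b : bool) (xs : seq nat) : seq (nat * nat) :=
  if xs is x :: xs' then
    (x, if b then m else 0%N) :: (x, if b then 0%N else m) :: zigzag m (~~ b) xs'
  else [::].

Lemma ud_cornersE k d m x0 w :
  ud_corners k d m x0 w = zigzag m false [seq (x0 + x)%N | x <- traversals k d w].
Proof.
rewrite /ud_corners; set xs := traversals k d w; rewrite -[false]/(odd 0).
(* The index starts at j, whose parity keeps the direction of travel while the list shrinks. *)
suff H j s : flatten [seq let x := (x0 + nth 0 s (i - j))%N in
               if odd i then [:: (x, m); (x, 0%N)] else [:: (x, 0%N); (x, m)]
          | i <- iota j (size s)] = zigzag m (odd j) [seq (x0 + x)%N | x <- s].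
  by rewrite -H; congr flatten; apply: eq_map => i; rewrite subn0.
elim: s j => //= x s IH j; rewrite subnn /= -[~~ odd j]/(odd j.+1) -IH.
case: (odd j) => /=; do 2 congr cons; congr flatten; apply/eq_in_map => i;
  by rewrite mem_iota => /andP[ji _]; rewrite subnS -[(i - j)%N]prednK // subn_gt0.
Qed.

Lemma mem_walk_from_route p q c s : s \in p :: route p q ->
  s \in p :: walk_from p (q :: c).
Proof. by rewrite walk_from_cons -cat_cons mem_cat => ->. Qed.

Lemma mem_walk_from_tail p q c s : s \in q :: walk_from q c ->
  s \in p :: walk_from p (q :: c).
Proof.
have qr : q \in p :: route p q by rewrite -{1}(last_route p q) mem_last.
rewrite walk_from_cons -cat_cons mem_cat inE => /predU1P[->|->].
  by rewrite qr.
exact: orbT.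
Qed.

(** The two corners at abscissa x have heights 0 and m, so the route between them meets every
    height, in either direction. *)
Lemma mem_zigzag_walk m b p xs x y : x \in xs -> (y <= m)%N ->
  (x, y) \in p :: walk_from p (zigzag m b xs).
Proof.
move=> + ym; elim: xs p b => //= x' xs IH p b.
rewrite inE => /predU1P[->|/IH mem_xs]; apply: mem_walk_from_tail.
  by apply/mem_walk_from_route/mem_vertical_route; case: b; lia.
exact: mem_walk_from_tail.
Qed.

(** Each traversal ends at the height where the next one starts, so the connecting moves are
    horizontal; as the abscissae increase, their lengths telescope. *)
Lemma size_zigzag_walk m b p x xs : path leq x xs ->
  size (walk_from p (zigzag m b (x :: xs))) =
  (grid_dist p (x, if b then m else 0) + ((size xs).+1 * m + (last x xs - x)))%N.
Proof.
elim: xs p b x => [|y xs IH] p b x.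
  move=> _; rewrite !walk_from_cons size_cat size_route size_cat size_route /=.
  by rewrite /grid_dist /=; case: b; lia.
move=> /= /andP[xy s]; have le : (y <= last y xs)%N.
  have /predU1P[->//|] := mem_last y xs.
  exact: allP (order_path_min leq_trans s) _.
rewrite 2!walk_from_cons size_cat size_route size_cat size_route (IH _ _ y) //.
by case: b; rewrite /grid_dist /=; lia.
Qed.

(** * Positions of the traversals and heights of the stops *)

Lemma separation_gt0 k h : (0 < k)%N -> (h <= k)%N ->
  (0 < separation k h.*2)%N.
Proof. by rewrite /separation doubleK; lia. Qed.

Section Traversals.

Context (k d : nat).
Hypothesis r_gt0 : (0 < separation k d)%N.

Lemma size_traversals w : (0 < w)%N ->
  size (traversals k d w) = (w.-1 %/ separation k d).+2.
Proof. by case: w => // w _; rewrite /traversals size_rcons size_mkseq. Qed.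

Lemma head_traversals w : head 0%N (traversals k d w) = 0%N.
Proof. by case: w => //= w; rewrite muln0. Qed.

Lemma last_traversals w : last 0%N (traversals k d w) = w.
Proof. by case: w => // w; rewrite /traversals last_rcons. Qed.

Lemma sorted_traversals w :
  sorted (fun x y => x <= y <= x + separation k d)%N (traversals k d w).
Proof.
case: w => // w; rewrite /traversals -[w.+1.-1]/w; set r := separation k d.
apply/(sortedP 0%N) => i; rewrite size_rcons size_mkseq !ltnS => iq.
rewrite !nth_rcons size_mkseq ltnS iq nth_mkseq ?ltnS //.
(* The width is now [w.+1]; these bounds say that the last gap, from the last multiple of r to
   [w.+1], is between 1 and r. *)
have qw := leq_divM w r; have wq : (w < (w %/ r).+1 * r)%N := ltn_ceil w r_gt0.
case: ltngtP => [ltq|?|eq]; [|lia|].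
  by rewrite nth_mkseq // mulnS; lia.
by move: qw wq; rewrite eq eqxx -/r; nia.
Qed.

End Traversals.

Lemma traversals_le k d w x : (0 < separation k d)%N ->
  x \in traversals k d w -> (x <= w)%N.
Proof.
move=> r0; case: w => // w; rewrite /traversals mem_rcons inE => /predU1P[->//|].
case/mapP => i; rewrite mem_iota /= => iq ->.
have qw := leq_divM w (separation k d); rewrite add0n ltnS in iq; nia.
Qed.

(** A height in a given residue class modulo d is determined by its quotient by d, one of 0, ...,
    m/d; one more stop is at height m. *)
Lemma size_stop_heights d m i : (0 < d)%N ->
  (size (stop_heights d m i) <= m %/ d + 2)%N.
Proof.
move=> d0; rewrite /stop_heights addn2 ltnS; set c := if odd i then _ else _.
have -> : (m %/ d).+1 = size [seq (j * d + c %% d)%N | j <- iota 0 (m %/ d).+1].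
  by rewrite size_map size_iota.
apply: uniq_leq_size => [|y]; first by rewrite filter_uniq ?iota_uniq.
rewrite mem_filter mem_iota => /andP[/eqP yc ym]; apply/mapP.
by exists (y %/ d)%N; [rewrite mem_iota /= ltnS leq_div2r | rewrite -yc -divn_eq].
Qed.

(** For d = 2h the heights jd and jd + d/2 are the even and the odd multiples of h, so the parity of
    q selects the traversals that stop at height qh. *)
Lemma mem_stop_heights h m i q : odd q = odd i -> (q * h <= m)%N ->
  (q * h)%N \in stop_heights h.*2 m i.
Proof.
move=> qi qm; rewrite inE mem_filter mem_iota /= ltnS qm andbT doubleK -qi.
apply/orP; right; rewrite -{1}(odd_double_half q) mulnDl -doubleMl doubleMr addnC.
by rewrite modnMDl; case: (odd q); rewrite ?mul1n ?mul0n.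
Qed.

Lemma size_ud_stops k d m x0 w : (0 < d)%N ->
  (size (ud_stops k d m x0 w) <= size (traversals k d w) * (m %/ d + 2))%N.
Proof.
move=> d0; rewrite /ud_stops size_allpairs_dep sumnE big_map.
rewrite -[X in (_ <= X * _)%N](size_iota 0); elim: (iota _ _) => [|i s IH].
  by rewrite big_nil.
by rewrite big_cons mulSn leq_add // size_stop_heights.
Qed.

Lemma ud_stops_bound k d m x0 w s : (0 < separation k d)%N ->
  s \in ud_stops k d m x0 w ->
  (s.1 \in [seq x0 + x | x <- traversals k d w]%N) && (s.2 <= m)%N.
Proof.
move=> r0 /allpairsPdep[i [y [iw ys ->]]] /=.
rewrite mem_iota in iw; rewrite map_f ?mem_nth //=.
by move: ys; rewrite inE => /predU1P[->//|]; rewrite mem_filter mem_iota ltnS => /and3P[].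
Qed.

(** * Coverage by a single up-and-down path *)

(** If qh is the largest multiple of h not above y, one traversal stops at qh and the other at
    (q+1)h, or at m if (q+1)h exceeds m. As y lies between these stops, the distances add up to
    their difference, at most h. *)
Lemma neighbour_heights (R : realType) h m i (y : R) : (0 < h)%N ->
  0 <= y <= m%:R ->
  exists a b : nat, [/\ a \in stop_heights h.*2 m i,
                        b \in stop_heights h.*2 m i.+1
                      & `|y - a%:R| + `|y - b%:R| <= h%:R].
Proof.
move=> h0 /andP[y0 ym]; have hR : 0 < h%:R :> R by rewrite ltr0n.
have yh0 : 0 <= y / h%:R by rewrite divr_ge0 ?ler0n.
have /andP[] := truncn_itv yh0; set q := Num.truncn _.
rewrite ler_pdivlMr // ltr_pdivrMr // -!natrM => lo hi.
have qm : (q * h <= m)%N by rewrite -(ler_nat R); exact: le_trans ym.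
have [b [bS yb bq]] : exists b : nat,
    [/\ forall j, odd j = ~~ odd q -> b \in stop_heights h.*2 m j,
        y <= b%:R & b%:R <= (q.+1 * h)%:R :> R].
  case: (leqP (q.+1 * h) m) => [q1m|mq1].
    by exists (q.+1 * h)%N; split=> [j jq||//]; [rewrite mem_stop_heights //= jq | exact: ltW].
  by exists m; split=> [j _||]; [rewrite inE eqxx | | rewrite ler_nat ltnW].
have aS j : odd j = odd q -> (q * h)%N \in stop_heights h.*2 m j.
  by move=> jq; rewrite mem_stop_heights.
have dist : `|y - (q * h)%:R| + `|y - b%:R| <= h%:R.
  rewrite ger0_norm ?subr_ge0 // ler0_norm ?subr_le0 //.
  by move: bq; rewrite mulSn natrD; lra.
have [iq|iq] := eqVneq (odd i) (odd q).
  by exists (q * h)%N, b; split=> //; [exact: aS | apply: bS; rewrite /= iq].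
exists b, (q * h)%N; split; [apply: bS | apply: aS => /= | by rewrite addrC];
  by move: iq; case: (odd i) (odd q) => [] [].
Qed.

(** At equal indices [a :: xs] and [xs] hold consecutive abscissae, so i names the gap containing x;
    it is the index of the first entry of [xs] that is at least x. *)
Lemma sorted_locate (R : realType) r a xs (x : R) :
  path (fun u v => u <= v <= u + r)%N a xs -> (0 < size xs)%N ->
  a%:R <= x <= (last a xs)%:R ->
  exists2 i, (i < size xs)%N &
    (nth 0%N (a :: xs) i)%:R <= x <= (nth 0%N xs i)%:R /\
    (nth 0%N xs i <= nth 0%N (a :: xs) i + r)%N.
Proof.
elim: xs a => // b xs IH a /= /andP[/andP[ab br] srt] _ /andP[ax xl].
case: (leP x b%:R) => xb; first by exists 0%N; rewrite //= ax xb.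
case: xs IH srt xl => [|c xs] IH srt xl; first by move: xl => /=; lra.
have [|i ix []] := IH b srt isT; first by rewrite xl ltW.
by move=> xi gap; exists i.+1.
Qed.

Lemma ud_cover (R : realType) k h m x0 w (p : R * R) :
  (0 < h)%N -> (h <= k)%N -> (0 < w)%N ->
  x0%:R <= p.1 <= (x0 + w)%:R -> 0 <= p.2 <= m%:R ->
  exists2 s, s \in ud_stops k h.*2 m x0 w & l1dist p (embed R s) <= k%:R.
Proof.
move=> h0 hk w0 px py; set xs := traversals k h.*2 w.
have sepE : separation k h.*2 = (2 * k - h)%N by rewrite /separation doubleK.
have r0 : (0 < separation k h.*2)%N by rewrite sepE; lia.
have szx : size xs = (w.-1 %/ _).+2 := size_traversals k h.*2 w0.
have := sorted_traversals r0 w; have := last_traversals k h.*2 w.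
have := head_traversals k h.*2 w; rewrite -/xs.
case exs : xs szx => [|z xs'] /= szx z0 lw srt; first by case: szx.
have {}szx : size xs' = (w.-1 %/ separation k h.*2).+1 by case: szx.
rewrite {}z0 in exs lw srt *.
have [||i iq] := @sorted_locate R _ _ _ (p.1 - x0%:R) srt; rewrite ?szx // ?lw.
  by rewrite natrD in px; lra.
move=> [/andP[x1 x2] gap].
have [a [b [aS bS dist]]] := neighbour_heights i h0 py.
have A : ((x0 + nth 0%N xs i)%N, a) \in ud_stops k h.*2 m x0 w.
  by apply: allpairs_f_dep aS; rewrite mem_iota -/xs exs /= add0n ltnS ltnW.
have B : ((x0 + nth 0%N xs i.+1)%N, b) \in ud_stops k h.*2 m x0 w.
  by apply: allpairs_f_dep bS; rewrite mem_iota -/xs exs /= add0n ltnS.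
rewrite exs in A; rewrite exs /= in B.
set u := nth _ (_ :: _) i in x1 gap A; set v := nth _ _ i in x2 gap B.
have gapR : v%:R - u%:R + h%:R <= 2 * k%:R :> R.
  have : (v + h <= u + 2 * k)%N.
    by move: hk gap; rewrite sepE; clearbody u v; clear; lia.
  by rewrite -(ler_nat R) natrD [(u + _)%:R]natrD natrM; lra.
(* The two l1 distances add up to at most (v - u) + h, hence at most 2k: if the left stop is farther
   than k, the right one is within k. *)
have [near|far] := leP (l1dist p (embed R ((x0 + u)%N, a))) k%:R.
  by exists ((x0 + u)%N, a).
exists ((x0 + v)%N, b) => //; move: far; rewrite /l1dist /embed /= !natrD.
rewrite (ger0_norm (x := p.1 - _)); last by lra.
by rewrite (ler0_norm (x := p.1 - (x0%:R + v%:R))); lra.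
Qed.

Lemma grid_point_zigzag n m b xs : all (fun x => x <= n)%N xs ->
  all (grid_point n m) (zigzag m b xs).
Proof.
elim: xs b => //= x xs IH b /andP[xn /IH ->].
by rewrite /grid_point /= xn; case: b; rewrite leqnn.
Qed.

(** The final height depends on the parity of the number of traversals; the bound m suffices for the
    length of the junction. *)
Lemma last_zigzag m b p x xs :
  (last p (zigzag m b (x :: xs))).1 = last x xs /\
  ((last p (zigzag m b (x :: xs))).2 <= m)%N.
Proof.
elim: xs b p x => [|y xs IH] b p x; last exact: (IH (~~ b) (x, if b then 0%N else m) y).
by case: b.
Qed.

(** The route from p to itself is empty, so the first corner may stay in the list; this avoids
    splitting the concatenation of two corner lists. *)
Lemma walk_throughE p c : walk_through (p :: c) = p :: walk_from p (p :: c).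
Proof. by rewrite walk_from_cons [route p p]size0nil // size_route /grid_dist; lia. Qed.

(** * Rounded widths of the two rectangles *)

Section Ceilings.

Context {R : realType}.

Lemma absz_ceil_bounds (x : R) : 0 <= x ->
  x <= `|Num.ceil x|%N%:R /\ `|Num.ceil x|%N%:R < x + 1.
Proof.
move=> x0; have c0 : 0 <= Num.ceil x by rewrite -(ler_int R) (le_trans x0) ?ceil_ge.
have /andP[lo hi] := ceil_itv x.
have <- : (Num.ceil x)%:~R = `|Num.ceil x|%N%:R :> R.
  by rewrite -{1}(gez0_abs c0).
split=> //; move: lo; rewrite intrD; lra.
Qed.

Context {n : nat} {gamma : R}.
Hypotheses (n_gt0 : (0 < n)%N) (gamma_ge0 : 0 <= gamma) (gamma_lt1 : gamma < 1).

Let nR : 0 < n%:R :> R. Proof. by rewrite ltr0n. Qed.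

Lemma left_width_bounds :
  gamma * n%:R <= (left_width n gamma)%:R < gamma * n%:R + 1.
Proof. by apply/andP/absz_ceil_bounds/mulr_ge0 => //; exact: ltW. Qed.

Lemma right_width_bounds :
  (1 - gamma) * n%:R <= (right_width n gamma)%:R < (1 - gamma) * n%:R + 1.
Proof. by apply/andP/absz_ceil_bounds/mulr_ge0; rewrite ?subr_ge0; exact: ltW. Qed.

(** Each ceiling exceeds its argument by less than 1 and the arguments add up to n, so the sum is
    below n + 2. Since gamma < 1 the right width is positive, while the left one may be 0. *)
Lemma widths : [/\ (left_width n gamma <= n)%N, (0 < right_width n gamma <= n)%N
  & (n <= left_width n gamma + right_width n gamma <= n + 1)%N].
Proof.
have /andP[l1 l2] := left_width_bounds; have /andP[r1 r2] := right_width_bounds.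
have /andP[g0 gn] : 0 <= gamma * n%:R < n%:R by rewrite mulr_ge0 ?gtr_pMl // ltW.
split.
- by rewrite -ltnS -(ltr_nat R) -natr1; lra.
- apply/andP; split; first by rewrite -(ltr_nat R); lra.
  by rewrite -ltnS -(ltr_nat R) -natr1; lra.
- apply/andP; split; first by rewrite -(ler_nat R) natrD; lra.
  by rewrite addn1 -ltnS -(ltr_nat R) -addn2 !natrD; lra.
Qed.

End Ceilings.

(** * The mixed path: coverage, length and number of stops *)

Section Mixed.

Context {R : realType} {k n m h : nat} {gamma : R}.
Hypotheses (n_gt0 : (0 < n)%N) (hk : (h < k)%N).
Hypothesis mixed : mixed_type k h.*2 gamma.

Let gamma_ge0 : 0 <= gamma. Proof. by case: mixed => _ _ /andP[]. Qed.
Let gamma_lt1 : gamma < 1. Proof. by case: mixed => _ _ /andP[]. Qed.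

Let lw := left_width n gamma.
Let rw := right_width n gamma.
Let rs := right_start n gamma.
Let xs1 := [seq (0 + x)%N | x <- traversals k h.*2 lw].
Let xs2 := [seq (rs + x)%N | x <- traversals k h.+1.*2 rw].
Let c1 := zigzag m false xs1.
Let c2 := zigzag m false xs2.

Let r1_gt0 : (0 < separation k h.*2)%N.
Proof. by rewrite separation_gt0; lia. Qed.
Let r2_gt0 : (0 < separation k h.+1.*2)%N.
Proof. by rewrite separation_gt0; lia. Qed.

Let left_nil : h = 0%N -> lw = 0%N.
Proof.
case: mixed => _ _ _ [h1|[_ g0] _]; first by lia.
by rewrite /lw /left_width g0 mul0r ceil0.
Qed.

Let bounds := widths n_gt0 gamma_ge0 gamma_lt1.

Let xs2_ex : exists xs, xs2 = rs :: xs /\ last rs xs = n.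
Proof.
have := head_traversals k h.+1.*2 rw; have := last_traversals k h.+1.*2 rw.
have [_ /andP[rw0 rwn] _] := bounds.
have := size_traversals k h.+1.*2 rw0.
rewrite /xs2; case: traversals => //= x xs _ lx x0; rewrite {}x0 in lx *.
exists [seq (rs + x)%N | x <- xs]; rewrite addn0; split => //.
by rewrite -{1}[rs]addn0 last_map lx /rs /right_start subnK.
Qed.

(** The first corner of the right path when the left one is empty; [c2] is nonempty, so the default
    is never reached. *)
Let p0 := head (0%N, 0%N) (c1 ++ c2).

Lemma mixed_walkE : mixed_walk k n m h.*2 gamma = p0 :: walk_from p0 (c1 ++ c2).
Proof.
rewrite /mixed_walk -doubleS !ud_cornersE -/xs1 -/xs2 -/c1 -/c2 /p0.
case E : (c1 ++ c2) => [|p c]; last by rewrite walk_throughE.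
have [xs [exs _]] := xs2_ex; move: (congr1 size E).
by rewrite size_cat /c2 exs /= !addnS.
Qed.

Let xs1_le : all (fun x => x <= n)%N xs1.
Proof.
have [lwn _ _] := bounds.
by apply/allP => _ /mapP[x /traversals_le xw ->]; exact: leq_trans (xw r1_gt0) lwn.
Qed.

Let xs2_le : all (fun x => x <= n)%N xs2.
Proof.
have [_ /andP[_ rwn] _] := bounds.
apply/allP => _ /mapP[x /traversals_le xw ->]; have := xw r2_gt0.
by rewrite /rs /right_start -/rw; lia.
Qed.

Let mixed_stopsP s : (s \in mixed_stops k n m h.*2 gamma) =
  (s \in ud_stops k h.*2 m 0 lw) || (s \in ud_stops k h.+1.*2 m rs rw).
Proof. by rewrite !inE. Qed.

Lemma mixed_covering : covering_path R k n m
  (mixed_stops k n m h.*2 gamma) (mixed_walk k n m h.*2 gamma).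
Proof.
have [lwn /andP[rw0 rwn] /andP[sum_ge _]] := bounds.
have stopP s : s \in mixed_stops k n m h.*2 gamma ->
    (s.1 \in xs1) && (s.2 <= m)%N || (s.1 \in xs2) && (s.2 <= m)%N.
  by rewrite mixed_stopsP => /orP[] /ud_stops_bound -> //; rewrite orbT.
split.
- move=> s /stopP; rewrite /grid_point.
  by case/orP=> /andP[s1 ->]; rewrite andbT;
    [exact: (allP xs1_le) | exact: (allP xs2_le)].
- move=> p [/andP[px0 pxn] py].
  (* The widths add up to at least n, so [rs <= lw] and every point to the right of [lw] lies in the
     right rectangle. *)
  have [xl|xr] := leP p.1 lw%:R.
    (* If the left rectangle is empty, the right one starts at 0 and also covers the points with x =
       0. *)
    have [lw0|lw0] := posnP lw.
      have [|||||s sS sd] := @ud_cover R k h.+1 m rs rw p => //.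
        rewrite lw0 in xl sum_ge; rewrite /rs /right_start -/rw.
        by have -> : (n - rw)%N = 0%N by [lia]; rewrite add0n px0 (le_trans xl) ?ler0n.
      by exists s; rewrite // mixed_stopsP sS orbT.
    have [|||||s sS sd] := @ud_cover R k h m 0 lw p => //.
    + by rewrite lt0n; apply/eqP => /left_nil; lia.
    + exact: ltnW.
    + by rewrite px0.
    by exists s; rewrite // mixed_stopsP sS.
  have [|||||s sS sd] := @ud_cover R k h.+1 m rs rw p => //.
    rewrite /rs /right_start -/rw subnK // pxn andbT (le_trans _ (ltW xr)) //.
    by rewrite ler_nat; lia.
  by exists s; rewrite // mixed_stopsP sS orbT.
- rewrite mixed_walkE /sorted path_walk_from; split=> //.
  have gc : all (grid_point n m) (c1 ++ c2).
    by rewrite all_cat !grid_point_zigzag.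
  have gp : grid_point n m p0 by rewrite /p0; case: (c1 ++ c2) gc => //= p c /andP[].
  by rewrite /= gp grid_point_walk_from.
- move=> [x y] /stopP /= xy; rewrite mixed_walkE walk_from_cat -cat_cons mem_cat.
  case/orP: xy => /andP[xs ym]; first by rewrite mem_zigzag_walk.
  have := mem_zigzag_walk false (last p0 c1) xs ym; rewrite inE.
  (* The starting point of the second walk is the last vertex of the first one. *)
  case/predU1P=> [->|->]; last exact: orbT.
  by rewrite -last_walk_from mem_last.
Qed.

(** Each traversal costs m and the horizontal moves cost [lw + rw], at most n + 1. The junction goes
    from abscissa [lw] to (rs, 0), where [lw] exceeds [rs] by at most 1, and costs at most m + 1. *)
Lemma mixed_length : (path_length (mixed_walk k n m h.*2 gamma) <=
  (size (traversals k h.*2 (left_width n gamma))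
   + size (traversals k h.+1.*2 (right_width n gamma)) + 1) * m + n + 2)%N.
Proof.
have [lwn /andP[rw0 rwn] /andP[_ sum_le]] := bounds.
have rsE : (rs + rw = n)%N by rewrite /rs /right_start subnK.
rewrite mixed_walkE /path_length /= -(size_map (addn 0)) -/xs1.
rewrite -(size_map (addn rs) (traversals k h.+1.*2 rw)) -/xs2 walk_from_cat size_cat.
have srt2 : sorted leq xs2.
  rewrite sorted_map; apply: sub_sorted (sorted_traversals r2_gt0 rw) => x y /=.
  by rewrite leq_add2l => /andP[].
have srt1 : sorted leq xs1.
  rewrite sorted_map; apply: sub_sorted (sorted_traversals r1_gt0 lw) => x y /=.
  by rewrite leq_add2l => /andP[].
have len2 p : (size (walk_from p c2) <=
    grid_dist p (rs, 0%N) + (size xs2 * m + rw))%N.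
  have [xs [exs xn]] := xs2_ex; rewrite /c2 exs in srt2 *.
  by rewrite size_zigzag_walk // xn /=; lia.
have last1 := last_traversals k h.*2 lw; have head1 := head_traversals k h.*2 lw.
move: (len2 (last p0 c1)); rewrite /p0 /c1.
have xs1E : xs1 = traversals k h.*2 lw by rewrite /xs1 (eq_map (g := id)) ?map_id.
(* If the left path is empty, the walk starts at the first corner of the right path and there is no
   junction. *)
move: last1 head1 srt1; rewrite -xs1E; case: xs1 => [_ _ _|x xs lx x0 srt].
  have [xs [exs _]] := xs2_ex; rewrite /c2 exs /= /grid_dist /=; nia.
rewrite /= in lx x0; rewrite {}x0 in lx srt *.
rewrite [head _ _]/=; have [y1 y2] := last_zigzag m false (0%N, 0%N) 0%N xs.
rewrite size_zigzag_walk // {1}/grid_dist lx; move: y1 y2.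
case: (last (0%N, 0%N) _) => u y /=; rewrite lx /grid_dist => -> /=; nia.
Qed.

Lemma mixed_count : (#|` mixed_stops k n m h.*2 gamma| <=
  size (traversals k h.*2 (left_width n gamma)) * (m %/ h.*2 + 2)
  + size (traversals k h.+1.*2 (right_width n gamma)) * (m %/ h.+1.*2 + 2))%N.
Proof.
rewrite /mixed_stops card_fseq (leq_trans (size_undup _)) // size_cat leq_add //.
  (* The bound on the stops per traversal requires d > 0; for h = 0 there is no left traversal. *)
  have [h0|h0] := posnP h; last by rewrite size_ud_stops // double_gt0.
  by rewrite -/lw left_nil.
by rewrite -doubleS size_ud_stops.
Qed.
End Mixed.

(** * The values of f at even integers and the solution curve of the equation *)

Lemma f_cov_even (R : realType) k i : (i <= k)%N ->
  f_cov k (2 * i%:R) = 2 * i%:R * (2 * k%:R - i%:R) :> R.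
Proof.
move=> ik; have ikR : i%:R <= k%:R :> R by rewrite ler_nat.
by rewrite /f_cov ifT; [field | lra].
Qed.

Lemma f_cov_even_gt0 (R : realType) k i : (0 < i <= k)%N ->
  0 < f_cov k (2 * i%:R) :> R.
Proof.
move=> /andP[i0 ik]; rewrite f_cov_even //.
have i0R : 0 < i%:R :> R by rewrite ltr0n.
have ikR : i%:R <= k%:R :> R by rewrite ler_nat.
by rewrite mulr_gt0 //; lra.
Qed.

(* The perspective map (x, F) |-> (x Ns / F, Ns / F) sends the graph of f_UBC to
   the solution curve of the equation.  It preserves segments but not their
   affine parameters: s goes to t = s F_{i+1} / ((1 - s) F_i + s F_{i+1}). *)
Lemma UBC_equation_polyline (R : realType) (m n k : nat) (L T : R) :
  (0 < k)%N -> let Ns : R := (m * n)%:R - 2 * k%:R ^+ 2 in 0 < Ns ->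
  UBC_equation k n m L T <->
  polyline_to_infty k
    (fun i => (2 * i%:R * Ns / f_cov k (2 * i%:R), Ns / f_cov k (2 * i%:R)))
    (Ns / f_cov_infty R k) (L, T - 1).
Proof.
move=> k0 Ns Ns0; rewrite /UBC_equation -/Ns; set y := T - 1.
have kR : 1 <= k%:R :> R by rewrite ler1n.
have finf : 0 < f_cov_infty R k by rewrite /f_cov_infty; nra.
have fpos i : (1 <= i < k)%N -> 0 < f_cov k (2 * i%:R) :> R /\ 0 < f_cov k (2 * i.+1%:R) :> R.
  by move=> ir; split; apply: f_cov_even_gt0; lia.
split=> [[x2 yf]|].
- set x := L / y in x2 yf.
  (* Division by zero gives 0, which is less than 2. *)
  have y0 : y != 0 by apply/eqP => y0; move: x2; rewrite /x y0 invr0 mulr0; lra.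
  have LE : L = x * y by rewrite /x divfK.
  have [[i [s [ir /= sr xE fE]]]|[/= xk fE]] :=
    (f_UBC_graph x (f_UBC k x) k0).1 (conj x2 erefl).
    have [a0 b0] := fpos i ir; move: yf; rewrite {}fE; move: a0 b0.
    set a := f_cov k _; set b := f_cov k _ => a0 b0; set F := _ + _ => yF.
    have /andP[s0 s1] := sr; have F0 : 0 < F by rewrite /F; nra.
    have yE : y = Ns / F by rewrite -yF mulfK // gt_eqF.
    left; exists i, (s * b / F); split=> //=; rewrite -/a -/b.
    + apply/andP; split; first by rewrite divr_ge0 ?mulr_ge0 // ltW.
      by rewrite ler_pdivrMr // mul1r /F; nra.
    + rewrite LE yE xE /F; field.
      by rewrite -/F !gt_eqF.
    + rewrite yE /F; field.
      by rewrite -/F !gt_eqF.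
  right; move: yf; rewrite fE /= f_cov2k => yF.
  have yE : y = Ns / f_cov_infty R k by rewrite -yF mulfK // gt_eqF.
  have yge0 : 0 <= y by rewrite yE divr_ge0 // ltW.
  by split=> //; rewrite -mulrA -yE LE ler_wpM2r.
(* For the converse it suffices to exhibit a point (x, F) of the graph of [f_UBC] with L = x y and y
   F = Ns. *)
- have graph x F : polyline_to_infty k (fun i => (2 * i%:R, f_cov k (2 * i%:R)))
      (f_cov_infty R k) (x, F) -> 0 < y -> L = x * y -> y * F = Ns ->
      2 <= L / y /\ y * f_UBC k (L / y) = Ns.
    move=> /(f_UBC_graph _ _ k0)[x2 ->] y0 -> yF.
    by rewrite mulfK ?gt_eqF.
  case=> [[i [t [ir /= tr LE yE]]]|[/= Lk yE]].
    have [a0 b0] := fpos i ir; move: LE yE a0 b0.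
    set a := f_cov k _; set b := f_cov k _ => LE yE a0 b0.
    (* Solving t = s b / ((1 - s) a + s b) for s gives s = t a / G. *)
    have /andP[t0 t1] := tr; set G := (1 - t) * b + t * a.
    have G0 : 0 < G by rewrite /G; nra.
    have yG : y = Ns * G / (a * b) by rewrite yE /G; field; rewrite !gt_eqF.
    have y0 : 0 < y by rewrite yG !(divr_gt0, mulr_gt0).
    set s := t * a / G.
    apply: (graph ((1 - s) * (2 * i%:R) + s * (2 * i.+1%:R)) ((1 - s) * a + s * b)) => //.
    + left; exists i, s; split=> //.
      apply/andP; split; first by rewrite divr_ge0 ?mulr_ge0 // ltW.
      by rewrite ler_pdivrMr // mul1r /G; nra.
    + rewrite LE yG /s /G; field.
      by rewrite -/G !gt_eqF.
    + rewrite yG /s /G; field.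
      by rewrite -/G !gt_eqF.
  have y0 : 0 < y by rewrite yE divr_gt0.
  apply: (graph (L / y) (f_cov_infty R k)) => //; last first.
  + by rewrite yE divfK // gt_eqF.
  + by rewrite divfK // gt_eqF.
  right; split=> //=; rewrite ler_pdivlMr // yE mulrA.
  by move: Lk; rewrite f_cov2k.
Qed.

(** * Error estimates for the mixed path *)

Lemma natr_separation (R : realType) k i : (i <= k)%N ->
  (separation k i.*2)%:R = 2 * k%:R - i%:R :> R.
Proof. by move=> ik; rewrite /separation doubleK natrB ?natrM //; lia. Qed.

(** The inverse of 0 is 0, so the degenerate type d = 0 is included. *)
Lemma natr_double_inv_le (R : realType) i : 0 <= (i.*2%:R^-1 : R) <= 2^-1.
Proof.
case: i => [|i]; first by rewrite invr0 lexx invr_ge0 ler0n.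
by rewrite invr_ge0 ler0n lef_pV2 ?posrE ?ltr0n ?ler_nat.
Qed.

(** Rounding a width up costs at most 1, which the [w.-1] in the number of traversals absorbs. *)
Lemma size_traversals_le (R : realType) k d w (x : R) :
  (0 < separation k d)%N -> 0 <= x -> w%:R <= x + 1 ->
  (size (traversals k d w))%:R <= x / (separation k d)%:R + 2.
Proof.
move=> r0 x0 wx; have rR : 0 < (separation k d)%:R :> R by rewrite ltr0n.
have [->|w0] := posnP w; first by rewrite /= addr_ge0 // divr_ge0 // ltW.
rewrite size_traversals // -addn2 natrD lerD2r ler_pdivlMr // -natrM.
apply: (@le_trans _ _ w.-1%:R); first by rewrite ler_nat leq_divM.
by rewrite -(ltn_predK w0) -natr1 /= in wx *; lra.
Qed.

(* The widths of the two rectangles are only controlled through the nominal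
   ratio g, which may differ from gamma: the ratio g = 1, not allowed for gamma,
   is approximated by a gamma close to 1, whose right rectangle has width 1. *)
Lemma mixed_path_bounds (R : realType) (m n k h : nat) (gamma g L T : R) :
  (0 < n)%N -> (n <= m)%N -> (h < k)%N ->
  let Ns : R := (m * n)%:R - 2 * k%:R ^+ 2 in 0 < Ns ->
  mixed_type k h.*2 gamma -> 0 <= g <= 1 -> (0 < h)%N \/ g = 0 ->
  (left_width n gamma)%:R <= g * n%:R + 1 ->
  (right_width n gamma)%:R <= (1 - g) * n%:R + 1 ->
  g * (2 * h%:R * Ns / f_cov k (2 * h%:R))
    + (1 - g) * (2 * h.+1%:R * Ns / f_cov k (2 * h.+1%:R)) <= L ->
  g * (Ns / f_cov k (2 * h%:R)) + (1 - g) * (Ns / f_cov k (2 * h.+1%:R)) = T - 1 ->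
  exists L' T' : R,
    [/\ feasible k n m L' T',
        from_mixed_path k n m L' T',
        L' - L <= 2 * k%:R ^+ 2 / Ns * L + 10 * m%:R
      & T' - T <= 2 * k%:R ^+ 2 / Ns * T + 10 * m%:R + 12].
Proof.
move=> n0 nm hk Ns Ns0 mix g01 hg lw rw LE TE.
have cov := mixed_covering n0 hk mix.
have len := mixed_length (m := m) n0 hk mix.
have count := mixed_count (m := m) n0 hk mix.
exists (path_length (mixed_walk k n m h.*2 gamma))%:R, (#|` mixed_stops k n m h.*2 gamma|)%:R.
set L' := path_length _ in len *; set T' := #|` _| in count *.
suff [HL HT] : L'%:R - L <= 2 * k%:R ^+ 2 / Ns * L + 10 * m%:R /\
    T'%:R - T <= 2 * k%:R ^+ 2 / Ns * T + 10 * m%:R + 12.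
  split=> //; last by exists h.*2, gamma.
  by exists (mixed_stops k n m h.*2 gamma), (mixed_walk k n m h.*2 gamma).
have /andP[g0 g1] := g01.
have nR : 1 <= n%:R :> R by rewrite ler1n.
have nmR : n%:R <= m%:R :> R by rewrite ler_nat.
have hkR : h%:R + 1 <= k%:R :> R by rewrite natr1 ler_nat.
have h0R : 0 <= h%:R :> R by rewrite ler0n.
have NsE : m%:R * n%:R = Ns + 2 * k%:R ^+ 2 by rewrite /Ns natrM; ring.
have k0 : (0 < k)%N by case: (k) hk.
have sep0 i : (i <= k)%N -> (0 < separation k i.*2)%N := separation_gt0 k0.
have s1 := size_traversals_le (sep0 h (ltnW hk)) (mulr_ge0 g0 (ler0n _ n)) lw.
have s2 := size_traversals_le (sep0 h.+1 hk) (mulr_ge0 (_ : 0 <= 1 - g) (ler0n _ n)) rw.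
move: s2; rewrite subr_ge0 => /(_ g1) s2.
have div_le d : (m %/ d)%:R <= m%:R * d%:R^-1 :> R.
  case: d => [|d]; first by rewrite divn0 invr0 mulr0.
  by rewrite ler_pdivlMr ?ltr0n // -natrM ler_nat leq_divM.
have /andP[e10 e1] := natr_double_inv_le R h.
have /andP[e20 e2] := natr_double_inv_le R h.+1.
have d1 := div_le h.*2; have d2 := div_le h.+1.*2.
rewrite !natr_separation // 1?ltnW // in s1 s2.
have rA : 1 <= 2 * k%:R - h%:R :> R by lra.
have rB : 1 <= 2 * k%:R - h.+1%:R :> R by rewrite -natr1; lra.
(* Nominal numbers of traversals per unit of width: L is at least Ns (A + B), and T - 1 equals Ns
   (A/d + B/(d+2)). *)
set A := g / (2 * k%:R - h%:R); set B := (1 - g) / (2 * k%:R - h.+1%:R).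
have s1' : (size (traversals k h.*2 (left_width n gamma)))%:R <= n%:R * A + 2.
  by move: s1; rewrite mulrAC [_ * n%:R]mulrC.
have s2' : (size (traversals k h.+1.*2 (right_width n gamma)))%:R <= n%:R * B + 2.
  by move: s2; rewrite mulrAC [_ * n%:R]mulrC.
set a := size _ in s1' len count; set b := size _ in s2' len count.
have A0 : 0 <= A <= g by rewrite divr_ge0 ?ler_pdivrMr ?ler_peMr //; lra.
have B0 : 0 <= B <= 1 - g by rewrite divr_ge0 ?ler_pdivrMr ?ler_peMr ?subr_ge0 //; lra.
have dblR i : i.*2%:R = 2 * i%:R :> R by rewrite -mul2n natrM.
have fB : f_cov k (2 * h.+1%:R) = 2 * h.+1%:R * (2 * k%:R - h.+1%:R) :> R.
  exact: f_cov_even.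
have rB0 : 2 * k%:R - h.+1%:R != 0 :> R by rewrite gt_eqF // (lt_le_trans ltr01).
have rA0 : 2 * k%:R - h%:R != 0 :> R by rewrite gt_eqF // (lt_le_trans ltr01).
have hS0 : h.+1%:R != 0 :> R by rewrite pnatr_eq0.
have [LA TA] : g * (2 * h%:R * Ns / f_cov k (2 * h%:R)) = Ns * A /\
    g * (Ns / f_cov k (2 * h%:R)) = Ns * (A / h.*2%:R).
  (* For g = 0 both sides vanish, whatever the inverse of f(2h) is. *)
  rewrite /A dblR; case: hg => [hpos|->]; last by rewrite !mul0r mulr0.
  have hn0 : h%:R != 0 :> R by rewrite pnatr_eq0 -lt0n.
  by rewrite f_cov_even 1?ltnW //; split; field; rewrite hn0 rA0.
have [LB TB] : (1 - g) * (2 * h.+1%:R * Ns / f_cov k (2 * h.+1%:R)) = Ns * B /\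
    (1 - g) * (Ns / f_cov k (2 * h.+1%:R)) = Ns * (B / h.+1.*2%:R).
  rewrite /B dblR fB; move: (h.+1%:R) rB0 hS0 => x x1 x2.
  by split; field; rewrite x1 x2.
rewrite {}LA {}LB -mulrDr in LE; rewrite {}TA {}TB -mulrDr in TE.
move/andP: A0 => [A0 Ag]; move/andP: B0 => [B0 Bg].
split.
  have q : A + B <= L / Ns by rewrite ler_pdivlMr // mulrC.
  (* As N = Ns + 2k^2, the claim becomes L' <= N L / Ns + 10m; the same rewriting serves for T. *)
  have -> : 2 * k%:R ^+ 2 / Ns * L = m%:R * n%:R * (L / Ns) - L.
    by rewrite NsE; field; rewrite gt_eqF.
  have qN : m%:R * n%:R * (A + B) <= m%:R * n%:R * (L / Ns).
    by rewrite ler_wpM2l // mulr_ge0 ?ler0n.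
  have lenR : L'%:R <= ((n%:R * A + 2) + (n%:R * B + 2) + 1) * m%:R + n%:R + 2 :> R.
    apply: le_trans (_ : ((a + b + 1) * m + n + 2)%:R <= _); first by rewrite ler_nat.
    rewrite natrD lerD2r natrD lerD2r natrM ler_wpM2r ?ler0n //.
    by rewrite natrD lerD2r natrD lerD.
  (* Beyond N (A + B) there remains 5m + n + 2, at most 8m. *)
  lra.
have w : A / h.*2%:R + B / h.+1.*2%:R <= T / Ns.
  by rewrite ler_pdivlMr // mulrC TE; lra.
have -> : 2 * k%:R ^+ 2 / Ns * T = m%:R * n%:R * (T / Ns) - T.
  by rewrite NsE; field; rewrite gt_eqF.
have wN : m%:R * n%:R * (A / h.*2%:R + B / h.+1.*2%:R) <= m%:R * n%:R * (T / Ns).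
  by rewrite ler_wpM2l // mulr_ge0 ?ler0n.
have countR : T'%:R <= (n%:R * A + 2) * (m%:R / h.*2%:R + 2)
                      + (n%:R * B + 2) * (m%:R / h.+1.*2%:R + 2) :> R.
  apply: le_trans (_ : (a * (m %/ h.*2 + 2) + b * (m %/ h.+1.*2 + 2))%:R <= _).
    by rewrite ler_nat.
  by rewrite natrD !natrM lerD // ler_pM ?ler0n // natrD lerD2r.
(* Expanding the products leaves 2n(A + B) + 2m(1/d + 1/(d+2)) + 8 beyond the main term, at most 2n
   + 2m + 8. *)
have nA : n%:R * (A + B) <= n%:R by rewrite ler_piMr //; lra.
have mA : m%:R * (h.*2%:R^-1 + h.+1.*2%:R^-1) <= m%:R :> R by rewrite ler_piMr //; lra.
lra.
Qed.

(** * Choice of the mixed path on each piece of the polyline *)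

Unset Implicit Arguments.

Theorem theorem5 (R : realType) (m n k : nat)
    (n_gt0 : (0 < n)%N) (n_le_m : (n <= m)%N) (k_gt0 : (0 < k)%N)
    (N_gt : (2 * k ^ 2 < m * n)%N) :
  let Nstar : R := (m * n)%:R - 2 * k%:R ^+ 2 in
  (forall L T : R, UBC_equation k n m L T ->
     exists L' T' : R,
       [/\ feasible k n m L' T',
           from_mixed_path k n m L' T',
           L' - L <= 2 * k%:R ^+ 2 / Nstar * L + 10 * m%:R
         & T' - T <= 2 * k%:R ^+ 2 / Nstar * T + 10 * m%:R + 12])
  /\
  (forall L T : R,
     UBC_equation k n m L T <->
     polyline_to_infty k
       (fun i => (2 * i%:R * Nstar / f_cov k (2 * i%:R),
                  Nstar / f_cov k (2 * i%:R)))
       (Nstar / f_cov_infty R k) (L, T - 1)).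
Proof.
move=> Ns.
have Ns0 : 0 < Ns by rewrite /Ns subr_gt0 -natrX -natrM ltr_nat.
split=> L T; last exact: UBC_equation_polyline.
have nR : 0 < n%:R :> R by rewrite ltr0n.
move=> /(UBC_equation_polyline _ _ k_gt0 Ns0)
  [[i [t [/andP[i0 ik] /andP[t0 t1] /= LE TE]]]|[/= Lk TE]].
  have [tz|tnz] := eqVneq t 0.
    (* Vertex i calls for the excluded ratio 1. Here gamma n = n - 1/2, so the widths are n and 1,
       within the rounding allowed for g = 1. *)
    pose gamma : R := 1 - (2 * n%:R)^-1.
    have gn : (2 * n%:R)^-1 * n%:R = 2^-1 :> R by field; rewrite gt_eqF.
    have n2 : 0 < (2 * n%:R)^-1 :> R by rewrite invr_gt0 mulr_gt0.
    have n2' : (2 * n%:R)^-1 <= 1 / 2 :> R.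
      by rewrite div1r lef_pV2 ?posrE ?mulr_gt0 // ler_peMr // ler1n.
    have [g0 g1] : 0 <= gamma /\ gamma < 1 by rewrite /gamma; lra.
    have [lwn _ _] := widths n_gt0 g0 g1.
    have /andP[_ rw] := right_width_bounds n_gt0 g1.
    apply: (@mixed_path_bounds R m n k i gamma 1) => //.
    + by split; rewrite ?odd_double ?g0 //;
         [move: ik; clear; lia | left; rewrite double_gt0].
    + by rewrite ler01 lexx.
    + by left.
    + by rewrite mul1r (@le_trans _ _ n%:R) ?ler_nat ?lerDl.
    + have rw1 : (right_width n gamma <= 1)%N.
        rewrite -ltnS -(ltr_nat R); move: rw; rewrite /gamma; lra.
      by rewrite subrr mul0r add0r -[1]/(1%:R) ler_nat.
    + by rewrite LE tz subrr subr0 !mul0r.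
    + by rewrite TE tz subrr subr0 !mul0r.
  (* Inside an edge, vertex i has weight 1 - t and corresponds to the left path, of type 2i. *)
  have [g0 g1] : 0 <= 1 - t /\ 1 - t < 1 by move/eqP: tnz; lra.
  have /andP[_ lw] := left_width_bounds (n := n) g0.
  have /andP[_ rw] := right_width_bounds n_gt0 g1.
  apply: (@mixed_path_bounds R m n k i (1 - t) (1 - t)) => //;
    rewrite ?(ltW lw) ?(ltW rw) ?(ltW g1) ?g0 //.
  + by split; rewrite ?odd_double ?g0 //;
         [move: ik; clear; lia | left; rewrite double_gt0].
  + by left.
  + by rewrite subKr LE.
  + by rewrite subKr TE.
(* On the horizontal ray T is that of vertex k and L is at least that of vertex k, so the pure
   type-2k path serves, written as the mixed type (2k - 2, 0); for k = 1 this is (0, 0). *)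
have /andP[_ lw] := left_width_bounds (n := n) (lexx (0 : R)).
have /andP[_ rw] := right_width_bounds n_gt0 (@ltr01 R).
have kE : k.-1.+1 = k by rewrite prednK.
apply: (@mixed_path_bounds R m n k k.-1 0 0) => //;
  rewrite ?kE ?(ltW lw) ?(ltW rw) ?lexx ?ler01 //.
+ split; rewrite ?odd_double ?lexx ?ltr01 //; first by lia.
  by have [->|] := eqVneq k 1%N; [right | left; lia].
+ by right.
+ by rewrite mul0r add0r subr0 mul1r.
+ by rewrite TE f_cov2k; lra.
Qed.
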